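(* Let $n\geq 3$ and $1\leq k\leq n/2$ be integers, and let $\Gamma=GP(n,k)$ be the generalized Petersen graph. Then \[\mathrm{pmd}(\Gamma)=\begin{cases}3,& n=2k\text{ and }k\neq3,\\ 5,& n=4\text{ and }k=1,\\ 4,&\text{otherwise}.\end{cases}\]
   Context: The generalized Petersen graph $GP(n,k)$ is the simple graph with vertices $u_i,v_i$ for $i\in\mathbb{Z}_n$, and edges $u_iu_{i+1}$, $v_iv_{i+k}$, $u_iv_i$ for all $i\in\mathbb{Z}_n$ (when $n=2k$, the edges $v_iv_{i+k}$ and $v_{i+k}v_{i+2k}$ coincide and are counted once). A matching $M$ (a set of pairwise disjoint edges) of a graph $\Gamma=(V,E)$ is positive if there is $w\colon V\to\mathbb{R}$ with $w(u)+w(v)>0$ for every $uv\in M$ and $w(u)+w(v)<0$ for every $uv\in E\setminus M$. A positive matching decomposition (pmd) of $\Gamma$ is a partition $E=E_1\cup\cdots\cup E_p$ into pairwise disjoint subsets such that $E_i$ is a positive matching of $(V,E\setminus\bigcup_{j<i}E_j)$ for $i=1,\ldots,p$. $\mathrm{pmd}(\Gamma)$ denotes the smallest $p$ for which $\Gamma$ has a pmd with $p$ parts. *)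

(* Defs.v *)
From HB Require Import structures.
From mathcomp Require Import all_boot all_order all_algebra.
From mathcomp Require Import reals.
Set Implicit Arguments.
Unset Strict Implicit.
Unset Printing Implicit Defensive.
Import Order.TTheory GRing.Theory Num.Theory.
Local Open Scope ring_scope.

(* A graph on the finite vertex type V is given by its edge set: an edge uv is
   the unordered pair [set u; v], so parallel edges are identified. *)
Definition graph (V : finType) := {set {set V}}.

Definition simple_graph (V : finType) (E : graph V) :=
  forall e, e \in E -> #|e| = 2%N.

(* For edge sets, [trivIset M] says that the edges in M are pairwise disjoint. *)
Definition matching (V : finType) (E M : graph V) :=
  M \subset E /\ trivIset M.

Definition positive_matching (R : realType) (V : finType) (E M : graph V) :=
  matching E M /\
  exists w : V -> R,
    (forall u v, [set u; v] \in M -> 0 < w u + w v) /\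
    (forall u v, [set u; v] \in E :\: M -> w u + w v < 0).

(* Parts are indexed from 0 and may be empty; this does not change the smallest
   possible number of parts, since deleting an empty part leaves a
   decomposition. *)
Definition positive_matching_decomposition (R : realType) (V : finType)
    (E : graph V) (p : nat) (P : 'I_p -> graph V) :=
  [/\ \bigcup_(i < p) P i = E,
      forall i j : 'I_p, i != j -> [disjoint P i & P j]
    & forall i : 'I_p,
        positive_matching R (E :\: \bigcup_(j < p | (j < i)%N) P j) (P i)].

Definition has_pmd (R : realType) (V : finType) (E : graph V) (p : nat) :=
  exists P : 'I_p -> graph V, positive_matching_decomposition R E P.

(* "pmd(E) = p" *)
Definition pmd_eq (R : realType) (V : finType) (E : graph V) (p : nat) :=
  has_pmd R E p /\ forall q : nat, has_pmd R E q -> (p <= q)%N.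

(* u_i is [inl i] and v_i is [inr i].  The type 'Z_n is Z/nZ only for n >= 2. *)
Definition GP (n k : nat) : graph ('Z_n + 'Z_n)%type :=
  [set [set inl i; inl (i + 1)] | i : 'Z_n] :|:
  [set [set inr i; inr (i + k%:R)] | i : 'Z_n] :|:
  [set [set inl i; inr i] | i : 'Z_n].

Lemma GP_simple (n k : nat) :
  (3 <= n)%N -> (1 <= k)%N -> (2 * k <= n)%N -> simple_graph (GP n k).
Proof.
move=> n3 k1 kn e; have n1 : (1 < n)%N by apply: ltn_trans n3.
have k_neq0 : k%:R != 0 :> 'Z_n.
  rewrite -val_eqE /= val_Zp_nat // modn_small -?lt0n //.
  by apply: leq_trans kn; rewrite mul2n -addnn -addn1 leq_add2l.
have add_neq (i j : 'Z_n) : j != 0 -> i != i + j.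
  by move=> j0; rewrite -[X in X != _]addr0 (inj_eq (addrI i)) eq_sym.
by rewrite !inE => /orP[/orP[]|] /imsetP[i _ ->]; rewrite cards2 // eqE /= add_neq.
Qed.

(* Main.v *)
Require Import Defs.
From mathcomp Require Import all_boot all_order all_algebra.
From mathcomp Require Import reals.
From mathcomp Require Import zify lra.

Set Implicit Arguments.
Unset Strict Implicit.
Unset Printing Implicit Defensive.
Import Order.TTheory GRing.Theory Num.Theory.

(** Upper bounds.  A matching [M] is positive as soon as its edges can be given
    a low and a high end and a height [h] such that no two high ends are
    adjacent outside [M], and an edge outside [M] from the low end of [e] to the
    high end of [f] exists only if [h e > h f]: put weight about [-2h] on low
    ends, [2h+1] on high ends, and a very negative weight on the unmatched
    vertices.  A linear forest always splits into two positive matchings: number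
    the vertices along each path and give the vertex numbered [d] the weight
    [d] or [-d] according to parity; the edges become alternately positive and
    negative, and what is left is itself a matching ([has_pmd_of_forest]).

    So for [n <> 2k], other than [GP 4 1], it suffices to find two positive
    matchings whose removal leaves a linear forest.  Except for the odd prisms,
    the two matchings contain
    all spokes, split essentially by the parity of the index so that the
    [u]-ends of one class are pairwise nonadjacent, and also contain an edge of
    the outer cycle and of each of the [gcd k n] inner cycles
    ([has_pmd_of_cuts]).  Cutting the cycles is what forces the case distinction:
    an edge can be added only where its ends are free, hence some
    spokes move to the other class, and the heights must absorb the adjacencies
    this creates.  The cases are [n], [k] even; [k] odd; prisms with [n] even;
    and the remaining [n] odd, [k] even reduces to [k] odd through
    [GP n k = GP n (n - k)].  When [n = 2k] and [k <> 3] the [v]-vertices have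
    degree 2 and a single matching suffices before the forest.

    Lower bounds.  The three edges at [u_0] need three colours.  If all vertices
    have degree 3 and three parts suffice, the first part is a perfect matching
    [M]; summing its weight over the edges of [M] gives [w(V) > 0], and over the
    remaining 2-regular graph gives [2 w(V) < 0] ([colours_ge4]).  The two
    exceptional graphs [GP 6 3] and [GP 4 1] are settled by exhaustive search: an
    alternating closed walk, whose edges lie alternately in a part and in
    later parts, is impossible, since both halves have the same total weight, and
    every colouring with one colour too few contains two edges of one colour
    at a vertex or such a walk. *)

(** * Decompositions from edge colourings with integer weights *)

(** Addition of [a] in Z/nZ, as a relation on representatives that linear
    arithmetic can use directly. *)
Definition step (n a i j : nat) : Prop :=
  [/\ i < n, j < n & j = i + a \/ j + n = i + a].

Lemma step_modn n a i : a <= n -> i < n -> step n a i ((i + a) %% n).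
Proof.
move=> an ilt; have n0 : 0 < n by lia.
split=> //; first by rewrite ltn_mod.
have [lt|ge] := ltnP (i + a) n; first by left; rewrite modn_small.
right; rewrite -[in LHS](subnK ge) modnDr modn_small; lia.
Qed.

Lemma val_Zp_lt n (i : 'Z_n) : 1 < n -> i < n.
Proof. by move=> n1; rewrite -[X in _ < X](Zp_cast n1) ltn_ord. Qed.

Lemma step_Zp n a (i : 'Z_n) : 1 < n -> a <= n -> step n a i (i + a%:R : 'Z_n)%R.
Proof.
move=> n1 an.
suff -> : (i + a%:R)%R = (i + a) %% n :> nat.
  by apply: step_modn => //; apply: val_Zp_lt.
rewrite -[RHS]modnDmr -(val_Zp_nat n1 a) [LHS]/=.
by congr (_ %% _); apply: Zp_cast.
Qed.

Local Open Scope ring_scope.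

Lemma set2_sum (V : finType) (S : zmodType) (w : V -> S) x y a b :
  [set x; y] = [set a; b] -> w x + w y = w a + w b.
Proof.
move=> E.
have := set21 x y; rewrite E !inE => xab; have := set22 x y; rewrite E !inE => yab.
have := set21 a b; rewrite -E !inE => axy; have := set22 a b; rewrite -E !inE => bxy.
case/orP: xab => /eqP ?; subst; case/orP: yab => /eqP ?; subst => //.
- by move: bxy; rewrite orbb => /eqP ->.
- by rewrite addrC.
- by move: axy; rewrite orbb => /eqP ->.
Qed.

Definition outer n (i : 'Z_n) : {set 'Z_n + 'Z_n} := [set inl i; inl (i + 1)].
Definition inner n k (i : 'Z_n) : {set 'Z_n + 'Z_n} :=
  [set inr i; inr (i + k%:R)].
Definition spoke n (i : 'Z_n) : {set 'Z_n + 'Z_n} := [set inl i; inr i].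

(** A colouring describes the parts of a decomposition: [co i], [cs i] and [ct i]
    are the colours of the edges [u_i u_(i+1)], [u_i v_i] and [v_i v_(i+k)], and
    [wu c], [wv c] are weights for the part of colour [c]. *)
Section Colouring.
Variables (R : realType) (n k p : nat) (co cs ct : nat -> nat).
Variables (wu wv : nat -> nat -> int).

Definition classes (q : pred nat) : graph ('Z_n + 'Z_n)%type :=
  [set outer i | i : 'Z_n & q (co i)] :|: [set inner k i | i : 'Z_n & q (ct i)]
  :|: [set spoke i | i : 'Z_n & q (cs i)].

Lemma classesP (q : pred nat) e : reflect
  [\/ exists2 i : 'Z_n, q (co i) & e = outer i,
      exists2 i : 'Z_n, q (ct i) & e = inner k i
    | exists2 i : 'Z_n, q (cs i) & e = spoke i] (e \in classes q).
Proof.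
rewrite !inE -orbA; apply: (iffP or3P).
- by case=> /imsetP[i]; rewrite inE => qi ->;
    [apply: Or31 | apply: Or32 | apply: Or33]; exists i.
- by case=> -[i qi ->]; [apply: Or31 | apply: Or32 | apply: Or33];
    apply/imsetP; exists i; rewrite ?inE.
Qed.

(** What the weights of colour [c] must satisfy on an edge of colour [c'] whose
    ends have total weight [s]: the edges of smaller colour are already gone. *)
Definition signed (c c' : nat) (s : int) : Prop :=
  (c' = c -> 0 < s) /\ ((c < c')%N -> s < 0).

(** The colours need not be compared for different names of the same edge
    ([v_i v_(i+k)] and [v_(i+k) v_i] if [n = 2k]): the signs of the weights
    force them to agree, and more generally make the parts disjoint. *)
Lemma has_pmd_of_colouring :
  (2 < n)%N -> (k <= n)%N ->
  (forall i, (i < n)%N -> [/\ co i < p, cs i < p & ct i < p]%N) ->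
  (forall i j, step n 1 i j ->
     [/\ co i <> co j, cs i <> co i & cs j <> co i]) ->
  (forall i j, step n k i j ->
     [/\ n <> (2 * k)%N -> ct i <> ct j, cs i <> ct i & cs j <> ct i]) ->
  (forall c i j, (c < p)%N -> step n 1 i j ->
     signed c (co i) (wu c i + wu c j)) ->
  (forall c i j, (c < p)%N -> step n k i j ->
     signed c (ct i) (wv c i + wv c j)) ->
  (forall c i, (c < p)%N -> (i < n)%N -> signed c (cs i) (wu c i + wv c i)) ->
  has_pmd R (GP n k) p.
Proof.
move=> n2 kn Hp Mo Mt Wo Wt Ws.
have n1 : (1 < n)%N by lia.
pose W (c : nat) (x : 'Z_n + 'Z_n) : R :=
  match x with inl i => (wu c i)%:~R | inr i => (wv c i)%:~R end.
have signW q x y : [set x; y] \in classes q ->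
    exists c', [/\ q c', (c' < p)%N, [set x; y] \in classes (pred1 c') &
      forall c, (c < p)%N ->
      (c' = c -> 0 < W c x + W c y) /\ ((c < c')%N -> W c x + W c y < 0)].
  have go c' (s : int) c x' y' : signed c c' s ->
      W c x' + W c y' = s%:~R -> (c' = c -> 0 < W c x' + W c y') /\
        ((c < c')%N -> W c x' + W c y' < 0).
    by move=> [pos neg] ->; split=> [/pos|/neg]; rewrite ?ltr0z ?ltrz0.
  case/classesP=> -[i qi Ei]; have [lo ls lt] := Hp _ (val_Zp_lt i n1).
  - exists (co i); split=> // [|c cp]; first by apply/classesP/Or31; exists i => /=.
    apply: go (Wo _ _ _ cp (step_Zp i n1 _)) _; first lia.
    by rewrite (set2_sum _ Ei) /= -intrD.
  - exists (ct i); split=> // [|c cp]; first by apply/classesP/Or32; exists i => /=.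
    apply: go (Wt _ _ _ cp (step_Zp i n1 kn)) _.
    by rewrite (set2_sum _ Ei) /= -intrD.
  - exists (cs i); split=> // [|c cp]; first by apply/classesP/Or33; exists i => /=.
    apply: go (Ws _ _ cp (val_Zp_lt i n1)) _.
    by rewrite (set2_sum _ Ei) /= -intrD.
have GPE : GP n k = classes predT.
  apply/setP=> e; apply/idP/classesP.
  - by rewrite !inE => /orP[/orP[]|] /imsetP[i _ ->];
      [apply: Or31 | apply: Or32 | apply: Or33]; exists i.
  - rewrite !inE -orbA => Ee; apply/or3P.
    by case: Ee => -[i _ ->]; [apply: Or31 | apply: Or32 | apply: Or33];
      apply/imsetP; exists i.
pose P (c : 'I_p) := classes (pred1 (val c)).
have PE : \bigcup_(c < p) P c = GP n k.
  rewrite GPE; apply/setP=> e; apply/bigcupP/idP.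
    by case=> c _ /classesP[] [i _ Ei]; apply/classesP;
      [apply: Or31 | apply: Or32 | apply: Or33]; exists i.
  by case/classesP=> -[i _ Ei]; have [lo ls lt] := Hp _ (val_Zp_lt i n1);
    [exists (Ordinal lo) | exists (Ordinal lt) | exists (Ordinal ls)] => //;
    apply/classesP; [apply: Or31 | apply: Or32 | apply: Or33]; exists i => /=.
have pairP e : e \in GP n k -> exists x y, e = [set x; y].
  by rewrite !inE => /orP[/orP[]|] /imsetP[i _ ->]; eexists; eexists; reflexivity.
have Psub c : P c \subset GP n k by rewrite -PE; apply: bigcup_sup.
have disj (i j : 'I_p) : (i < j)%N -> [disjoint P i & P j].
  move=> ij; rewrite -setI_eq0; apply/eqP/setP=> e; rewrite in_set0 in_setI; apply/negP.
  case/andP=> ei ej; have [x [y Exy]] := pairP e (subsetP (Psub i) _ ei).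
  rewrite {}Exy in ei ej.
  case: (signW _ _ _ ei) => c1 [/eqP -> _ _] /(_ i (ltn_ord i)) [/(_ erefl) pos _].
  case: (signW _ _ _ ej) => c2 [/eqP -> _ _] /(_ i (ltn_ord i)) [_ /(_ ij)].
  by rewrite ltNge (ltW pos).
exists P; split=> // [i j|c].
  rewrite neq_ltn => /orP[]/disj //; by rewrite disjoint_sym.
split; first split.
- apply/subsetP=> e ec; rewrite in_setD (subsetP (Psub c) _ ec) andbT.
  apply/negP=> /bigcupP[j jc ej]; have := disj _ _ jc.
  by move/pred0P/(_ e); rewrite /= ej ec.
- apply/trivIsetP=> e f ee ff; apply: contraR => /pred0Pn[x /= /andP[xe xf]].
  have So (i : 'Z_n) : [/\ co i <> co (i + 1 : 'Z_n)%R, cs i <> co i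
      & cs (i + 1 : 'Z_n)%R <> co i] by apply: Mo (step_Zp i n1 _); lia.
  have St (i : 'Z_n) := Mt _ _ (step_Zp i n1 kn).
  have innerC (i : 'Z_n) : ct i = c -> ct (i + k%:R : 'Z_n)%R = c ->
      inner k (i + k%:R) = inner k i.
    have [diff _ _] := St i => c1 c2; have [n2k|/eqP/diff] := eqVneq n (2 * k)%N.
      by rewrite /inner -addrA -natrD addnn -mul2n -n2k pchar_Zp // addr0 setUC.
    by case; rewrite c1 c2.
  apply/eqP; suff: e = f by [].
  case/classesP: ee xe => -[i /eqP ci ->]; case/classesP: ff xf => -[j /eqP cj ->];
    rewrite !inE => /orP[]/eqP -> /orP[]/eqP // E;
    first [have {}E := inl_inj E | have {}E := inr_inj E];
    do ?[by rewrite E | by move/addIr: E => ->]; subst;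
    do ?[by rewrite innerC | by rewrite -innerC];
    by [case: (So i); congruence | case: (So j); congruence
       |case: (St i); congruence | case: (St j); congruence].
- exists (W c); split=> x y.
    by move=> /signW[c' [/eqP -> _ _ /(_ c (ltn_ord c))[pos _]]]; apply: pos.
  rewrite 2!in_setD => /andP[xyNc /andP[xyNlt]].
  rewrite GPE => /signW[c' [_ c'p xyc' /(_ c (ltn_ord c))[_ neg]]]; apply: neg.
  rewrite ltnNge leq_eqVlt; apply/negP=> /orP[/eqP c'c|c'c].
    by move: xyc'; rewrite c'c (negbTE xyNc).
  by case/bigcupP: xyNlt; exists (Ordinal c'p).
Qed.
End Colouring.

Lemma step_next n a i j : (a <= n)%N -> step n a i j -> j = ((i + a) %% n)%N.
Proof.
move=> an [ilt jlt [E|E]]; first by rewrite -E modn_small.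
by rewrite -E modnDr modn_small.
Qed.

(** * A linear forest takes two more matchings *)

(** Colours from [p] on mark the edges of the linear forest that remains after
    [p] matchings; [du] and [dv] number the vertices along its paths. *)
Section Forest.
Variables (R : realType) (n k p : nat) (co cs ct : nat -> nat).
Variables (wu wv : nat -> nat -> int) (du dv : nat -> nat).

Definition consecutive (a b : nat) : Prop := a = b.+1 \/ b = a.+1.

(** The forest edge between the vertices numbered [m] and [m+1] gets colour [p]
    or [p+1] according to the parity of [m]. *)
Let refine c a b : nat := if (c < p)%N then c else (p + odd (minn a b))%N.
(** With weight [d] at odd numbers and [-d] at even numbers, the edge from [m]
    to [m+1] has total weight 1 if [m] is even and -1 otherwise. *)
Let extend (w : nat -> int) c d : int :=
  if (c < p)%N then w c else if c == p then
  if odd d then d%:Z else - d%:Z else 1.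

Let refine_signed (w w' : nat -> int) c c' a b : (c < p.+2)%N ->
  ((c < p)%N -> signed c c' (w c + w' c)) -> ((p <= c')%N -> consecutive a b) ->
  signed c (refine c' a b) (extend w c a + extend w' c b).
Proof.
rewrite /refine /extend => cp2 S A; have [cp|cp] := ltnP c p.
  by have [P N] := S cp; split; case: ifP => //; lia.
case: eqP => cE; case: ltnP => c'p; split; try lia.
all: have [] := A c'p => ->; case: ifP; case: ifP; lia.
Qed.

Let refine_lt c a b : (refine c a b < p.+2)%N.
Proof. rewrite /refine; case: ifP; lia. Qed.

Let refine_neq c c' a b b' d : (c = c' -> (p <= c)%N) ->
  ((p <= c)%N -> consecutive a b) -> ((p <= c')%N -> consecutive b' d) ->
  ((p <= c)%N -> (p <= c')%N -> [\/ b' = b /\ a <> d, b' = a /\ b <> d,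
     d = b /\ a <> b' | d = a /\ b <> b']) ->
  refine c a b <> refine c' b' d.
Proof.
rewrite /refine => N A A' D; case: ltnP => cp; case: ltnP => c'p; try lia.
case: (A cp) (A' c'p) (D cp c'p) => ? [] ? [] [] *; lia.
Qed.

(** Requiring the two forest neighbours of a vertex to have different numbers
    makes consecutive edges of a path alternate in colour. *)
Lemma has_pmd_of_forest :
  (2 < n)%N -> (k <= n)%N ->
  (forall i j, step n 1 i j -> [/\ co i = co j -> (p <= co i)%N,
     cs i = co i -> (p <= co i)%N & cs j = co i -> (p <= co i)%N]) ->
  (forall i j, step n k i j ->
     [/\ n <> (2 * k)%N -> ct i = ct j -> (p <= ct i)%N,
         cs i = ct i -> (p <= ct i)%N & cs j = ct i -> (p <= ct i)%N]) ->
  (forall c i j, (c < p)%N -> step n 1 i j ->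
     signed c (co i) (wu c i + wu c j)) ->
  (forall c i j, (c < p)%N -> step n k i j ->
     signed c (ct i) (wv c i + wv c j)) ->
  (forall c i, (c < p)%N -> (i < n)%N -> signed c (cs i) (wu c i + wv c i)) ->
  (forall i j, step n 1 i j -> (p <= co i)%N -> consecutive (du i) (du j)) ->
  (forall i j, step n k i j -> (p <= ct i)%N -> consecutive (dv i) (dv j)) ->
  (forall i, (i < n)%N -> (p <= cs i)%N -> consecutive (du i) (dv i)) ->
  (forall i j l, step n 1 i j -> step n 1 j l ->
     (p <= co i)%N -> (p <= co j)%N -> du i <> du l) ->
  (forall i j l, step n k i j -> step n k j l -> n <> (2 * k)%N ->
     (p <= ct i)%N -> (p <= ct j)%N -> dv i <> dv l) ->
  (forall i j, step n 1 i j -> (p <= co i)%N ->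
     ((p <= cs i)%N -> du j <> dv i) /\ ((p <= cs j)%N -> du i <> dv j)) ->
  (forall i j, step n k i j -> (p <= ct i)%N ->
     ((p <= cs i)%N -> dv j <> du i) /\ ((p <= cs j)%N -> dv i <> du j)) ->
  has_pmd R (GP n k) p.+2.
Proof.
move=> n2 kn Mo Mt Wo Wt Ws Lo Lt Ls Do Dt Dos Dts.
have n1 : (1 <= n)%N by lia.
have next1 := step_next n1; have nextk := step_next kn.
pose co' i := refine (co i) (du i) (du ((i + 1) %% n)%N).
pose ct' i := refine (ct i) (dv i) (dv ((i + k) %% n)%N).
pose cs' i := refine (cs i) (du i) (dv i).
apply: (@has_pmd_of_colouring _ _ _ _ co' cs' ct'
  (fun c i => extend (wu^~ i) c (du i))
  (fun c i => extend (wv^~ i) c (dv i))) => //.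
- by move=> i _; split; apply: refine_lt.
- move=> i j ij; have [ilt jlt _] := ij; have [M1 M2 M3] := Mo _ _ ij.
  have jl := step_modn n1 jlt; move: (ij) => /next1 ji.
  have [D1 D2] : _ /\ _ := conj (Dos _ _ ij) (Do _ _ _ ij jl).
  rewrite /co' /cs' -ji; split; apply: refine_neq => //.
  all: try by [apply: Lo | apply: Ls | lia].
  + by move=> ci cj; apply: Or41; split=> //; apply: D2.
  + by move=> si ci; have [D _] := D1 ci; apply: Or42; split=> //; move/esym; apply: D.
  + by move=> sj ci; have [_ D] := D1 ci; apply: Or44; split=> //; move/esym; apply: D.
- move=> i j ij; have [ilt jlt _] := ij; have [M1 M2 M3] := Mt _ _ ij.
  have jl := step_modn kn jlt; move: (ij) => /nextk ji.
  have [D1 D2] : _ /\ _ := conj (Dts _ _ ij) (Dt _ _ _ ij jl).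
  rewrite /ct' /cs' -ji; split=> [n2k||]; apply: refine_neq => //.
  all: try by [apply: Lt | apply: Ls | lia].
  + by move=> ci cj; apply: Or41; split=> //; apply: D2.
  + by move=> si ci; have [D _] := D1 ci; apply: Or41; split=> //; move/esym; apply: D.
  + by move=> sj ci; have [_ D] := D1 ci; apply: Or43; split=> //; move/esym; apply: D.
- move=> c i j cp ij; rewrite /co' -(next1 _ _ ij).
  by apply: refine_signed => // ?; [apply: Wo | apply: Lo].
- move=> c i j cp ij; rewrite /ct' -(nextk _ _ ij).
  by apply: refine_signed => // ?; [apply: Wt | apply: Lt].
- move=> c i cp ilt; rewrite /cs'.
  by apply: refine_signed => // ?; [apply: Ws | apply: Ls].
Qed.
End Forest.

(** * Two matchings that contain all spokes and cut all cycles *)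

(** The number of steps to the next cut numbers the paths into which the cycles
    of a translation are cut. *)
Lemma steps_to_cut n a (cut : pred nat) : (a <= n)%N ->
  (forall i, exists m, cut ((i + m * a) %% n)%N) ->
  exists d : nat -> nat,
    forall i j, step n a i j -> ~~ cut i -> d i = (d j).+1.
Proof.
move=> an H; exists (fun i => ex_minn (H i)) => i j ij ci.
have [ilt jlt _] := ij; have ji := step_next an ij.
case: ex_minnP => d di dmin; case: ex_minnP => d' dj' dmin'.
have shift m : ((j + m * a) %% n = (i + m.+1 * a) %% n)%N.
  by rewrite ji modnDml -addnA mulSn.
case: d di dmin => [|d] di dmin.
  by move: di; rewrite mul0n addn0 modn_small // (negbTE ci).
congr _.+1; apply/eqP; rewrite eqn_leq; apply/andP; split.
  by rewrite -ltnS; apply: dmin; rewrite -shift.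
by apply: dmin'; rewrite shift.
Qed.

(** The orbits of translation by [k] are the classes modulo [gcd k n]
    (Bezout). *)
Lemma steps_reach n k i j : (0 < n)%N -> (0 < k)%N ->
  i = j %[mod gcdn k n] -> exists m, ((i + m * k) %% n = j %% n)%N.
Proof.
move=> n0 k0 /eqP ij; have [km kn E _] := egcdnP n k0.
have le : (i <= j + n * i)%N by nia.
have /dvdnP[s Es] : (gcdn k n %| j + n * i - i)%N.
  rewrite -eqn_mod_dvd // (eqP ij).
  have /dvdnP[q ->] : (gcdn k n %| n * i)%N by rewrite dvdn_mulr ?dvdn_gcdr.
  by rewrite addnC modnMDl.
exists (s * km)%N; rewrite -mulnA E mulnDr -Es.
have -> : (i + (s * (kn * n) + (j + n * i - i)) = (s * kn + i) * n + j)%N by nia.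
by rewrite modnMDl.
Qed.

(** If every spoke has colour 0 or 1, the rest is contained in the outer and
    inner cycles, so it is a linear forest as soon as each of them loses an
    edge. *)
Lemma has_pmd_of_cuts (R : realType) n k (co cs ct : nat -> nat)
    (wu wv : nat -> nat -> int) :
  (2 < n)%N -> (0 < k <= n)%N -> n <> (2 * k)%N ->
  (forall i, (cs i < 2)%N) ->
  (exists2 i, (i < n)%N & (co i < 2)%N) ->
  (forall i, exists j, [/\ (j < n)%N, i = j %[mod gcdn k n] & (ct j < 2)%N]) ->
  (forall i j, step n 1 i j -> [/\ co i = co j -> (2 <= co i)%N,
     cs i <> co i & cs j <> co i]) ->
  (forall i j, step n k i j ->
     [/\ ct i = ct j -> (2 <= ct i)%N, cs i <> ct i & cs j <> ct i]) ->
  (forall c i j, (c < 2)%N -> step n 1 i j ->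
     signed c (co i) (wu c i + wu c j)) ->
  (forall c i j, (c < 2)%N -> step n k i j ->
     signed c (ct i) (wv c i + wv c j)) ->
  (forall c i, (c < 2)%N -> (i < n)%N -> signed c (cs i) (wu c i + wv c i)) ->
  has_pmd R (GP n k) 4.
Proof.
move=> n2 /andP[k0 kn] n2k Hs [o on co2] Ht Mo Mt Wo Wt Ws.
have n1 : (1 <= n)%N by lia.
have [du Hdu] : exists d : nat -> nat, forall i j, step n 1 i j ->
    ~~ (co i < 2)%N -> d i = (d j).+1.
  apply: (@steps_to_cut n 1 (fun i => co i < 2)%N) => // i.
  have [m E] : exists m, ((i + m * 1) %% n = o %% n)%N.
    by apply: steps_reach; rewrite ?gcd1n ?modn1 //; lia.
  by exists m; rewrite E modn_small.
have [dv Hdv] : exists d : nat -> nat, forall i j, step n k i j ->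
    ~~ (ct i < 2)%N -> d i = (d j).+1.
  apply: (@steps_to_cut n k (fun i => ct i < 2)%N) => // i.
  have [j [jn ij cj]] := Ht i; have [m E] : exists m, ((i + m * k) %% n = j %% n)%N.
    by apply: steps_reach => //; lia.
  by exists m; rewrite E modn_small.
have s2 i : (2 <= cs i)%N = false by apply/negbTE; rewrite -ltnNge.
apply: (@has_pmd_of_forest R n k 2 co cs ct wu wv du dv) => //.
- by move=> i j /Mo[].
- by move=> i j /Mt[].
- by move=> i j ij ci; left; apply: Hdu ij _; rewrite -leqNgt.
- by move=> i j ij ci; left; apply: Hdv ij _; rewrite -leqNgt.
- by move=> i _; rewrite s2.
- move=> i j l ij jl ci cj; rewrite (Hdu _ _ ij) -?leqNgt //.
  by rewrite (Hdu _ _ jl) -?leqNgt //; lia.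
- move=> i j l ij jl _ ci cj; rewrite (Hdv _ _ ij) -?leqNgt //.
  by rewrite (Hdv _ _ jl) -?leqNgt //; lia.
- by move=> i j _ _; rewrite !s2.
- by move=> i j _ _; rewrite !s2.
Qed.

(** * Four matchings when n differs from 2k *)

(** In the constructions below, everything is a case distinction on a few
    indices followed by linear arithmetic. *)
Ltac by_ifs := repeat match goal with x := _ |- _ => clear x end;
  repeat (case: ifP => ? //=); lia.
Ltac by_cases_step := move=> i j [ilt jlt [E|E]]; split; by_ifs.
Ltac by_cases_weights :=
  move=> [|[|c]] i j // _ [ilt jlt [E|E]]; split=> /=; by_ifs.
Ltac by_cases_label :=
  move=> i j [ilt jlt [E|E]]; rewrite /consecutive; by_ifs.
Ltac by_cases_turn := move=> i j l [ilt jlt [E|E]] [_ llt [E'|E']]; by_ifs.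

(** Colour 0 has the odd spokes and colour 1 the even ones, with the [u]-ends high.
    Since [k] is even, each inner edge joins vertices of equal parity, so it is
    disjoint from the spokes of the other parity: one edge of each even inner
    cycle is added to colour 0, one of each odd inner cycle to colour 1.  The
    outer cycle is cut at [u_(n-1) u_0], of colour 0; the spoke at [n-1] has to
    move to colour 1, where it coexists with the spoke at [n-2] because the
    latter gets its [v]-end high. *)
Lemma has_pmd_even_even (R : realType) n k : (2 < n)%N ->
  ~~ odd n -> ~~ odd k -> (0 < k)%N -> (2 * k < n)%N -> has_pmd R (GP n k) 4.
Proof.
move=> n2 ne ke k0 kn; pose d := gcdn k n.
have dk : (d %| k)%N by apply: dvdn_gcdl.
have dn : (d %| n)%N by apply: dvdn_gcdr.
have d0 : (0 < d)%N by rewrite gcdn_gt0 k0.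
have dlek : (d <= k)%N by apply: dvdn_leq.
have dle : (d <= n - 2 * k)%N.
  by apply: dvdn_leq; [lia | rewrite dvdn_sub // dvdn_mull].
pose co i := if i == n.-1 then 0%N else 2.
pose cs i := if odd i && (i != n.-1) then 0%N else 1%N.
pose ct i := if (i < d)%N then nat_of_bool (odd i) else 2.
pose wu c i : int := (match c with
  | 0%N => if i == n.-1 then 5 else if i == 0%N then -4 else if odd i then 3 else -10
  | _ => if i == n.-1 then 3 else if i == n.-2 then -4 else
         if odd i then -10 else 7 end)%Z.
pose wv c i : int := (match c with
  | 0%N => if odd i then (if i == n.-1 then -10 else -2) else
           if (i < d)%N then 1 else if (k <= i < k + d)%N then 0 else -10
  | _ => if i == n.-1 then -2 else if i == n.-2 then 5 else if odd i then
           (if (i < d)%N then 1 else if (k <= i < k + d)%N then 0 else -10)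
           else -6 end)%Z.
apply: (@has_pmd_of_cuts R n k co cs ct wu wv) => //; try lia.
- by move=> i; rewrite /cs; case: ifP.
- by exists n.-1; [lia | rewrite /co eqxx].
- move=> i; exists (i %% d)%N; rewrite modn_mod /ct ltn_mod d0; split=> //.
    by rewrite (@leq_trans d) ?ltn_mod //; lia.
  by case: odd.
all: clear dk dn; clearbody d.
- by rewrite /co /cs; by_cases_step.
- by rewrite /ct /cs; by_cases_step.
- rewrite /co /wu; by_cases_weights.
- rewrite /ct /wv; by_cases_weights.
- move=> [|[|//]] i _ ilt; rewrite /wu /wv /cs; split; by_ifs.
Qed.

(** Now inner edges join different parities (up to wrapping around), so the inner
    cycle through an odd [i] is cut at [v_i v_(i+k)], of colour 0, after
    moving the spoke at [i] to colour 1 with its [v]-end high; [i] runs over the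
    [d] odd numbers below [2d], one for each class modulo [d].  The outer cycle
    is cut at [x]: for [n] odd between the two consecutive even indices [n-1] and
    0, for [n] even after [2d+1], whose spoke also moves to colour 1.  In
    colour 1 an even index [i-k] must be higher than [i], and [i] higher than
    [i-1] and [i+1]; decreasing heights on [0..2d], and large ones outside, achieve
    this because [k >= 3]. *)
Lemma has_pmd_odd_step (R : realType) n k : (2 < n)%N ->
  odd k -> (3 <= k)%N -> (2 * gcdn k n + k <= n)%N ->
  (~~ odd n -> 2 * gcdn k n + 2 * k <= n)%N -> has_pmd R (GP n k) 4.
Proof.
move=> n2 ok k3 kn kne; pose d := gcdn k n.
have dk : (d %| k)%N by apply: dvdn_gcdl.
have od : odd d by apply: dvdn_odd dk ok.
have dlek : (d <= k)%N by apply: dvdn_leq => //; lia.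
rewrite -/d in kn kne.
have [x [top [bot Hx]]] : exists x top bot,
    (odd n /\ x = n.-1 /\ top = 0 /\ bot = n.-1 \/
    ~~ odd n /\ x = (2 * d).+1 /\ top = (2 * d).+1 /\ bot = (2 * d).+2)%N.
  case: (boolP (odd n)) => on; first by exists n.-1, 0%N, n.-1; left.
  by exists (2 * d).+1, (2 * d).+1, (2 * d).+2; right.
(* [first i]: the spoke at [i] has colour 0. *)
pose first i := [&& odd i, (2 * d < i)%N & i != x].
pose co i := if i == x then 0%N else 2.
pose cs i := if first i then 0%N else 1%N.
pose ct i := if odd i && (i < 2 * d)%N then 0%N else 2.
pose h i := (if odd i then n - i + 2 else if i <= 2 * d then n - i else 2 * n)%N.
pose wu c i : int := (match c with
  | 0%N => if i == top then 5 else if i == bot then -4 else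
           if first i then 3 else -10
  | _ => if first i then - (10 * n)%N%:Z else
         if odd i then - (2 * h i)%N%:Z else (2 * h i).+1%:Z end)%Z.
pose wv c i : int := (match c with
  | 0%N => if first i then -2 else if odd i && (i < 2 * d)%N then 1 else
           if ~~ odd i && (k < i < k + 2 * d)%N then 0 else -10
  | _ => if first i then - (10 * n)%N%:Z else
         if odd i then (2 * h i).+1%:Z else - (2 * h i)%N%:Z end)%Z.
apply: (@has_pmd_of_cuts R n k co cs ct wu wv) => //; try lia.
- by move=> i; rewrite /cs; case: ifP.
- by exists x; [lia | rewrite /co eqxx].
- move=> i; pose r := (i %% d)%N.
  have ri : (r = i %[mod d])%N by rewrite modn_mod.
  have : (r < d)%N by rewrite ltn_mod; lia.
  move: r ri => r ri rd; exists (if odd r then r else r + d)%N.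
  split; first by case: ifP => _; lia.
    by case: ifP; rewrite ?modnDr.
  by rewrite /ct; case or: (odd r); rewrite ?oddD or ?od /=; case: ifP => //; lia.
all: clear dk; clearbody d.
- by rewrite /co /cs /first; by_cases_step.
- by rewrite /ct /cs /first; by_cases_step.
- rewrite /co /wu /first /h; by_cases_weights.
- rewrite /ct /wv /first /h; by_cases_weights.
- move=> [|[|//]] i _ ilt; rewrite /wu /wv /cs /first /h; split; by_ifs.
Qed.

(** The spoke at 1 joins the even ones, and this frees [u_1] and [v_1] for
    the cuts [u_1 u_2] and [v_0 v_1].  In colour 0 the heights must decrease along
    the spoke at [n-1], the inner cut, the outer cut and the spoke at 3, which is
    impossible when [n-1 = 3]. *)
Lemma has_pmd_even_prism (R : realType) n : (6 <= n)%N -> ~~ odd n ->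
  has_pmd R (GP n 1) 4.
Proof.
move=> n6 ne.
pose co i := if i == 1%N then 0%N else 2.
pose cs i := if odd i && (2 < i)%N then 0%N else 1%N.
pose ct i := if i == 0%N then 0%N else 2.
pose wu c i : int := (match c with
  | 0%N => if i == 1%N then 5 else if i == 2%N then -4 else
           if ~~ odd i then -10 else if i == n.-1 then 9 else 3
  | _ => if i == 2%N then 7 else if i == 1%N then -4 else
         if odd i then -10 else 3 end)%Z.
pose wv c i : int := (match c with
  | 0%N => if i == 0%N then 7 else if i == 1%N then -6 else
           if ~~ odd i then -10 else if i == n.-1 then -8 else -2
  | _ => if i == 2%N then -6 else if i == 1%N then 5 else
         if odd i then -10 else -2 end)%Z.
apply: (@has_pmd_of_cuts R n 1 co cs ct wu wv) => //; try lia.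
- by move=> i; rewrite /cs; case: ifP.
- by exists 1%N; first lia.
- by move=> i; exists 0%N; rewrite gcd1n !modn1; split=> //; lia.
- by rewrite /co /cs; by_cases_step.
- by rewrite /ct /cs; by_cases_step.
- rewrite /co /wu; by_cases_weights.
- rewrite /ct /wv; by_cases_weights.
- move=> [|[|//]] i _ ilt; rewrite /wu /wv /cs; split; by_ifs.
Qed.

(** Here the spokes at [n-2] and [n-1] are kept for the forest, which becomes the
    Hamiltonian path [u_0 ... u_(n-2) v_(n-2) ... v_0 v_(n-1) u_(n-1)]. *)
Lemma has_pmd_odd_prism (R : realType) n : (2 < n)%N -> odd n ->
  has_pmd R (GP n 1) 4.
Proof.
move=> n2 on.
pose co i := if i == n.-1 then 0%N else if i == n.-2 then 1%N else 2.
pose cs i := if (n.-2 <= i)%N then 2 else if odd i then 0%N else 1%N.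
pose ct i := if i == n.-2 then 0%N else 2.
pose wu c i : int := (match c with
  | 0%N => if i == 0%N then 2 else if i == n.-1 then -1 else
           if i == n.-2 then -10 else if odd i then -4 else -10
  | _ => if i == n.-1 then 2 else if i == n.-2 then -1 else
         if odd i then -10 else -1 end)%Z.
pose wv c i : int := (match c with
  | 0%N => if i == n.-2 then 2 else if i == n.-1 then -1 else
           if odd i then 5 else -10
  | _ => if (n.-2 <= i)%N then -10 else if odd i then -10 else 2 end)%Z.
pose du i := if i == n.-1 then (2 * n).-1 else i.
pose dv i := (if i == n.-1 then 2 * n - 2 else 2 * n - 3 - i)%N.
apply: (@has_pmd_of_forest R n 1 2 co cs ct wu wv du dv) => //; try lia.
- by rewrite /co /cs; by_cases_step.
- by rewrite /ct /cs; by_cases_step.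
- rewrite /co /wu; by_cases_weights.
- rewrite /ct /wv; by_cases_weights.
- move=> [|[|c]] i // _ ilt; rewrite /wu /wv /cs; split; by_ifs.
- rewrite /co /du; by_cases_label.
- rewrite /ct /dv; by_cases_label.
- rewrite /cs /du /dv /consecutive => i ilt; by_ifs.
- rewrite /co /du; by_cases_turn.
- rewrite /ct /dv; by_cases_turn.
- rewrite /co /cs /du /dv; by_cases_step.
- rewrite /ct /cs /du /dv; by_cases_step.
Qed.

Lemma GP_rev n k : (1 < n)%N -> (k <= n)%N -> GP n (n - k) = GP n k.
Proof.
move=> n1 kn; rewrite /GP natrB // pchar_Zp // sub0r.
congr (_ :|: _ :|: _); apply/setP=> e; apply/imsetP/imsetP=> -[i _ ->].
  by exists (i - k%:R); rewrite // subrK setUC.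
by exists (i + k%:R); rewrite // addrK setUC.
Qed.

Lemma leq_double_gcd k n m : (0 < m)%N -> ~~ odd m -> odd (gcdn k n) ->
  (gcdn k n %| m)%N -> (2 * gcdn k n <= m)%N.
Proof.
move=> m0 em od dm; apply: dvdn_leq => //.
by rewrite Gauss_dvd ?coprime2n // dvdn2 em.
Qed.

Lemma has_pmd_GP4 (R : realType) (n k : nat) : (2 < n)%N -> (0 < k)%N ->
  (2 * k < n)%N -> (n, k) != (4, 1)%N -> has_pmd R (GP n k) 4.
Proof.
move=> n2 k0 kn n4; have [k1|k1] := eqVneq k 1%N.
  rewrite {}k1 in kn n4 *; have [on|en] := boolP (odd n).
    exact: has_pmd_odd_prism.
  by apply: has_pmd_even_prism => //; move: n4; rewrite xpair_eqE andbT; lia.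
have d0 : (0 < gcdn k n)%N by rewrite gcdn_gt0 k0.
have dk : (gcdn k n %| k)%N by apply: dvdn_gcdl.
have dn : (gcdn k n %| n)%N by apply: dvdn_gcdr.
have d2k : (gcdn k n %| n - 2 * k)%N by rewrite dvdn_sub // dvdn_mull.
have dlek : (gcdn k n <= k)%N by apply: dvdn_leq.
have dle : (gcdn k n <= n - 2 * k)%N by apply: dvdn_leq => //; lia.
have [ok|ek] := boolP (odd k).
  apply: has_pmd_odd_step => //; try lia.
  move=> en; have := @leq_double_gcd k n (n - 2 * k).
  rewrite (dvdn_odd dk ok) d2k => /(_ _ _ isT isT); lia.
have [on|en] := boolP (odd n); last exact: has_pmd_even_even.
rewrite -GP_rev; try lia.
have gE : gcdn (n - k) n = gcdn k n.
  rewrite -{2}(subnK (_ : k <= n)%N); last lia.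
  by rewrite gcdnDl gcdnC -{2}(subnK (_ : k <= n)%N) ?gcdnDr //; lia.
have := @leq_double_gcd k n k k0 ek (dvdn_odd dn on) dk => d2.
by apply: has_pmd_odd_step; rewrite ?gE ?on //; try lia.
Qed.

(** * Three matchings when n = 2k *)

(** Colour 0 has the outer edges [u_i u_(i+1)] with [i] odd except the last one,
    and the spokes at the two indices 0 and [n-1] left over, so all [u]-vertices
    are covered; heights increase with [i].  The rest is then made of the paths
    [u_i v_i v_(i+k) u_(i+k)] joined by the remaining outer edges.  For [k] even
    these close into cycles, each containing odd indices [i] and [i+k]; the low
    ends [u_i] and [u_(i+k)] allow adding [v_i v_(i+k)] to colour 0, which cuts
    the cycles that the two spokes do not cut. *)
Lemma has_pmd_double_even (R : realType) k : (2 <= k)%N -> ~~ odd k ->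
  has_pmd R (GP (2 * k) k) 3.
Proof.
move=> k2 ek; set n := (2 * k)%N.
have En : n = (k + k)%N by rewrite /n; lia.
clearbody n.
pose co i := if odd i && (i < n - 2)%N then 0%N else 1%N.
pose cs i := if (i == 0%N) || (i == n.-1) then 0%N else 1%N.
pose ct i := if [&& odd i, i != k.-1 & i != n.-1] then 0%N else 1%N.
pose wu (c i : nat) : int := (
  if i == 0%N then 0 else if i == n.-1 then - (2 * n)%N%:Z else
  if odd i then - (2 * i)%N%:Z else (2 * i).-1%:Z)%Z.
pose wv (c i : nat) : int := (
  if i == 0%N then 1 else if i == n.-1 then (2 * n).+1%:Z else
  if ~~ odd i || (i == k.-1) then - (9 * n)%N%:Z else if (i < k)%N then 1 else 0)%Z.
(* The pieces are [v_(j+1) u_(j+1) u_j v_j v_(j+k) u_(j+k) u_(j+1+k) v_(j+1+k)] for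
   [j] even, numbered 1 to 8; the other numbers are for the piece through the
   edge [u_(n-1) u_0]. *)
pose du i : nat := if (i <= 1)%N then (8 + i)%N else
  if (i < k)%N then (3 - odd i)%N else (6 + odd i)%N.
pose dv i : nat := if i == 1%N then 10 else if i == n.-1 then (if k == 2 then 11 else 0)
  else if (i < k)%N then (if odd i then 1 else 4) else (if odd i then 8 else 5).
apply: (@has_pmd_of_forest R n k 1 co cs ct wu wv du dv) => //; try lia.
- by rewrite /co /cs; by_cases_step.
- by rewrite /ct /cs; by_cases_step.
- rewrite /co /wu; by_cases_weights.
- rewrite /ct /wv; by_cases_weights.
- move=> [|[|c]] i // _ ilt; rewrite /wu /wv /cs; split; by_ifs.
- rewrite /co /du; by_cases_label.
- rewrite /ct /dv; by_cases_label.
- rewrite /cs /du /dv /consecutive => i ilt; by_ifs.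
- rewrite /co /du; by_cases_turn.
- rewrite /co /cs /du /dv; by_cases_step.
- rewrite /ct /cs /du /dv; by_cases_step.
Qed.

(** The same outer edges and spokes as for [k] even; but now the rest consists
    of a short path and one cycle winding through most of the paths
    [u_i v_i v_(i+k) u_(i+k)].  For [i < k] even the edge [v_i v_(i+k)] can be
    added to colour 0, with [v_i] low: its height lies between those of the outer
    edges at [u_i], which is high, and at [u_(i+k)], which is low.  At least one
    [i] with [2 <= i < k-2] is needed to cut the cycle, hence [k >= 5]. *)
Lemma has_pmd_double_odd (R : realType) k : (5 <= k)%N -> odd k ->
  has_pmd R (GP (2 * k) k) 3.
Proof.
move=> k5 ok; set n := (2 * k)%N.
have En : n = (k + k)%N by rewrite /n; lia.
clearbody n.
pose low i := ~~ odd i && (2 <= i < k - 2)%N.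
pose high i := odd i && (k + 2 <= i < n - 2)%N.
pose co i := if odd i && (i < n - 2)%N then 0%N else 1%N.
pose cs i := if (i == 0%N) || (i == n.-1) then 0%N else 1%N.
pose ct i := if low i || high i then 0%N else 1%N.
pose wu (c i : nat) : int := (
  if i == 0%N then 0 else if i == n.-1 then - (4 * n)%N%:Z else
  if odd i then - (4 * i)%N%:Z else (4 * i)%N%:Z - 3%:Z)%Z.
pose wv (c i : nat) : int := (
  if i == 0%N then 1 else if i == n.-1 then (4 * n)%N.+1%:Z else
  if low i then 2%:Z - (4 * i)%N%:Z else
  if high i then (4 * i)%N%:Z - (4 * k).+1%:Z else - (9 * n)%N%:Z)%Z.
(* The pieces are [v_i u_i u_(i+1) v_(i+1) v_(i+1+k) u_(i+1+k) u_(i+2+k) v_(i+2+k)] for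
   [i] even, numbered 1 to 8; the piece through [u_(n-1) u_0] is longer, and
   [v_(n-1) v_(k-1) u_(k-1) u_k v_k v_0] is numbered 0 to 5. *)
pose du i : nat := if (i <= 1)%N then (8 + i)%N else
  if i == k then 3 else if i == k.+1 then 12 else if i == k.+2 then 13 else
  if (i < k)%N then (2 + odd i)%N else (6 + odd i)%N.
pose dv i : nat := if i == 0%N then 5 else if i == 1%N then 10 else
  if i == k then 4 else if i == k.+1 then 11 else if i == k.+2 then 14 else
  if i == n.-1 then 0%N else if (i < k)%N then (if odd i then 4 else 1%N)
  else (if odd i then 8 else 5).
apply: (@has_pmd_of_forest R n k 1 co cs ct wu wv du dv) => //; try lia.
- by rewrite /co /cs; by_cases_step.
- by rewrite /ct /low /high /cs; by_cases_step.
- rewrite /co /wu; by_cases_weights.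
- rewrite /ct /wv /low /high; by_cases_weights.
- move=> [|[|c]] i // _ ilt; rewrite /wu /wv /low /high /cs; split; by_ifs.
- rewrite /co /du; by_cases_label.
- rewrite /ct /low /high /dv; by_cases_label.
- rewrite /cs /du /dv /consecutive => i ilt; by_ifs.
- rewrite /co /du; by_cases_turn.
- rewrite /co /cs /du /dv; by_cases_step.
- rewrite /ct /low /high /cs /du /dv; by_cases_step.
Qed.

(** * The exceptional graphs GP(4,1) and GP(6,3) *)

Ltac small_nat := case=> [|[|[|[|[|[|?]]]]]] //.
Ltac small_step := small_nat; small_nat; case=> // _ _ [] // _.
Ltac small_signs := small_nat; move=> + + _; small_step; by split; lia.
Ltac small_matching := small_step; by split.
Ltac small_labels := small_step; rewrite /consecutive /=; lia.
Ltac small_turns := small_nat; small_nat; small_nat;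
  case=> // _ _ [] // _; case=> // _ _ [] // _.

(** Colours by index; the colour 3 marks the path
    [v_0 u_0 u_3 v_3 v_2 u_2 u_1 v_1]. *)
Lemma has_pmd_GP41 (R : realType) : has_pmd R (GP 4 1) 5.
Proof.
pose wu : seq (seq int) :=
  [:: [:: -5; -5; 2; -1]; [:: 1; 1; -5; -5]; [:: -5; -5; -5; -5]].
pose wv : seq (seq int) :=
  [:: [:: -1; 2; -5; -5]; [:: -5; -5; -5; -5]; [:: 3; 3; -2; -2]].
apply: (@has_pmd_of_forest R 4 1 3 (nth 0%N [:: 1; 3; 0; 3]%N) (fun=> 3)
  (nth 0%N [:: 0; 2; 3; 2]%N)
  (fun c => nth 0 (nth [::] wu c)) (fun c => nth 0 (nth [::] wv c))
  (nth 0%N [:: 1; 6; 5; 2]%N) (nth 0%N [:: 0; 7; 4; 3]%N)) => //.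
- small_matching.
- small_matching.
- small_signs.
- small_signs.
- by small_nat; move=> + _; small_nat => _; split; lia.
- small_labels.
- small_labels.
- small_nat; rewrite /consecutive /=; lia.
- small_turns.
- small_turns.
- small_matching.
- small_matching.
Qed.

(** The matching of [has_pmd_double_odd] leaves a cycle here, which the single edge
    [v_1 v_4] of colour 1 cuts. *)
Lemma has_pmd_GP63 (R : realType) : has_pmd R (GP 6 3) 4.
Proof.
pose wu : seq (seq int) :=
  [:: [:: 0; -4; 5; -12; 13; -24]; [:: -9; -9; -9; -9; -9; -9]].
pose wv : seq (seq int) :=
  [:: [:: 1; -99; -99; -99; -99; 25]; [:: -9; 1; -9; -9; 1; -9]].
apply: (@has_pmd_of_forest R 6 3 2 (nth 0%N [:: 2; 0; 2; 0; 2; 2]%N)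
  (nth 0%N [:: 0; 2; 2; 2; 2; 0]%N) (nth 0%N [:: 2; 1; 2; 2; 1; 2]%N)
  (fun c => nth 0 (nth [::] wu c)) (fun c => nth 0 (nth [::] wv c))
  (nth 0%N [:: 2; 1; 2; 3; 4; 3]%N) (nth 0%N [:: 5; 0; 1; 4; 5; 0]%N)) => //.
- small_matching.
- small_matching.
- small_signs.
- small_signs.
- by small_nat; move=> + _; small_nat => _; split; lia.
- small_labels.
- small_labels.
- small_nat; rewrite /consecutive /=; lia.
- small_turns.
- small_matching.
- small_matching.
Qed.

(** * Lower bounds from degrees *)

(** A decomposition as lower bounds use it: the parts become colours of the edges,
    and [w j] are weights witnessing that part [j] is positive. *)
Definition valid_colouring (R : realType) (V : finType) (E : graph V) (q : nat)
    (c : {set V} -> nat) (w : nat -> V -> R) : Prop :=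
  [/\ forall e, e \in E -> (c e < q)%N,
      forall e f, e \in E -> f \in E -> c e = c f -> ~~ [disjoint e & f] -> e = f,
      forall x y, [set x; y] \in E -> 0 < w (c [set x; y]) x + w (c [set x; y]) y
    & forall j x y, [set x; y] \in E -> (j < c [set x; y])%N -> w j x + w j y < 0].

Lemma has_pmd_valid_colouring (R : realType) (V : finType) (E : graph V) q :
  has_pmd R E q -> exists c w, @valid_colouring R V E q c w.
Proof.
case=> P [cover disj pm].
have /fin_all_exists[w Hw] (i : 'I_q) := proj2 (pm i).
have inP e : e \in E -> exists i, e \in P i.
  by rewrite -cover => /bigcupP[i _ ei]; exists i.
pose c e : nat := if [pick i | e \in P i] is Some i then i else 0%N.
have cP e : e \in E -> exists2 i : 'I_q, e \in P i & c e = i.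
  move=> /inP[i ei]; rewrite /c; case: pickP => [j ej|/(_ i)]; last by rewrite ei.
  by exists j.
exists c, (fun j => if insub j is Some i then w i else fun=> 0); split.
- by move=> e /cP[i _ ->].
- move=> e f /cP[i ei ->] /cP[j fj ->] /val_inj ij; rewrite -{}ij in fj.
  have /trivIsetP T := proj2 (proj1 (pm i)).
  by move=> meet; apply/eqP; apply: contraNT meet; apply: T.
- by move=> x y /cP[i ei ->]; rewrite valK; apply: (proj1 (Hw i)).
- move=> j x y xyE; have [i ei ->] := cP _ xyE => ji.
  have jq := ltn_trans ji (ltn_ord i); rewrite (insubT (fun j => j < q)%N jq).
  apply: (proj2 (Hw (Sub j jq))); rewrite 2!in_setD xyE andbT.
  have outside (l : 'I_q) : (l < i)%N -> [set x; y] \notin P l.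
    move=> li; have /disj : l != i by rewrite neq_ltn li.
    by move/pred0P/(_ [set x; y]) => /=; rewrite ei andbT => ->.
  rewrite outside //=; apply/bigcupP=> -[l /= lj].
  by apply/negP/outside/(ltn_trans lj).
Qed.

Definition ends (T : Type) (e : T * T) : seq T := [:: e.1; e.2].

Section ValidColouring.
Variables (R : realType) (V : finType) (E : graph V) (q : nat).
Variables (c : {set V} -> nat) (w : nat -> V -> R).
Hypothesis valid : valid_colouring E q c w.

Lemma set2_injr (x y z : V) : [set x; y] = [set x; z] -> y = z.
Proof.
move=> E1; have := set22 x y; rewrite E1 !inE => /orP[/eqP yx|/eqP //].
by have := set22 x z; rewrite -E1 !inE yx orbb => /eqP.
Qed.

Lemma colour_neq x y z : y != z -> [set x; y] \in E -> [set x; z] \in E ->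
  c [set x; y] <> c [set x; z].
Proof.
case: valid => _ cE _ _ /eqP yz xy xz cc; apply: yz; apply: (@set2_injr x).
by apply: cE => //; apply/pred0Pn; exists x; rewrite /= !inE eqxx.
Qed.

Section Neighbours.
Variables (N1 N2 N3 : V -> V) (x0 : V).
Hypotheses (E1 : forall x, [set x; N1 x] \in E)
  (E2 : forall x, [set x; N2 x] \in E) (E3 : forall x, [set x; N3 x] \in E).

Let three_colours x : N1 x != N2 x -> N1 x != N3 x -> N2 x != N3 x ->
  let c1 := c [set x; N1 x] in let c2 := c [set x; N2 x] in
  let c3 := c [set x; N3 x] in
  [/\ c1 <> c2, c1 <> c3 & c2 <> c3] /\ [/\ c1 < q, c2 < q & c3 < q]%N.
Proof.
move=> n12 n13 n23; case: valid => lt _ _ _.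
by split; split; by [apply: lt | apply: colour_neq].
Qed.

Lemma colours_ge3 x : N1 x != N2 x -> N1 x != N3 x -> N2 x != N3 x -> (3 <= q)%N.
Proof.
by move=> n12 n13 /(three_colours n12 n13)[[? ? ?] [? ? ?]]; lia.
Qed.

(** In a cubic graph with at most three colours every vertex [x] has a neighbour
    [m x] along an edge of colour 0, so [m] permutes the vertices.  Writing [W] for
    the total weight of colour 0, the edges at all vertices sum up to [6W] and those
    of colour 0 to [2W > 0]; since the others are negative, [6W < 2W]. *)
Lemma colours_ge4 : injective N1 -> injective N2 -> injective N3 ->
  (forall x, [/\ N1 x != N2 x, N1 x != N3 x & N2 x != N3 x]) -> (4 <= q)%N.
Proof.
move=> I1 I2 I3 N; rewrite ltnNge; apply/negP=> q3.
case: (valid) => lt cE pos neg.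
pose m x := if c [set x; N1 x] == 0%N then N1 x else
            if c [set x; N2 x] == 0%N then N2 x else N3 x.
have key x : [/\ [set x; m x] \in E, c [set x; m x] = 0%N
    & w 0 (N1 x) + w 0 (N2 x) + w 0 (N3 x) + 2 * w 0 x <= w 0 (m x)].
  have [n12 n13 n23] := N x.
  have [] := three_colours n12 n13 n23.
  have := neg 0%N _ _ (E1 x); have := neg 0%N _ _ (E2 x).
  have := neg 0%N _ _ (E3 x); rewrite /m /=.
  have [e1|e1] := eqP; last have [e2|e2] := eqP.
  - move=> l3 l2 _ [d12 d13 _] _; split=> //.
    by have := l2 ltac:(lia); have := l3 ltac:(lia); lra.
  - move=> l3 _ l1 [d12 _ d23] _; split=> //.
    by have := l1 ltac:(lia); have := l3 ltac:(lia); lra.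
  - move=> _ l2 l1 [d12 d13 d23] [? ? ?]; split=> //; first lia.
    by have := l1 ltac:(lia); have := l2 ltac:(lia); lra.
have minj : injective m.
  move=> x y mxy; have [xE cx _] := key x; have [yE cy _] := key y.
  rewrite -mxy in yE cy; apply: (@set2_injr (m x)); rewrite ![[set m x; _]]setUC.
  apply: cE; rewrite ?cx ?cy //.
  by apply/pred0Pn; exists (m x); rewrite /= !inE eqxx !orbT.
have sumE (N0 : V -> V) : injective N0 -> \sum_x w 0 (N0 x) = \sum_x w 0 x.
  move=> I0; rewrite [RHS](reindex N0) //=; apply: onW_bij.
  exact: injF_bij.
have le : \sum_x (w 0 (N1 x) + w 0 (N2 x) + w 0 (N3 x) + 2 * w 0 x)
    <= \sum_x w 0 (m x).
  by apply: ler_sum => x _; have [] := key x.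
have gt : 0 < \sum_x (w 0 x + w 0 (m x)).
  rewrite lt0r sumr_ge0 ?andbT => [|x _]; last first.
    by have [xE cx _] := key x; rewrite ltW // -cx; apply: pos.
  rewrite psumr_neq0 => [|x _].
    apply/hasP; exists x0; rewrite ?mem_index_enum //=.
    by have [xE cx _] := key x0; rewrite -cx; apply: pos.
  by have [xE cx _] := key x; rewrite ltW // -cx; apply: pos.
move: le gt; rewrite !big_split /= -mulr_sumr !sumE //; lra.
Qed.
End Neighbours.

(** Edges of colour [j] cannot have the same multiset of ends as edges of larger
    colours: their total weights for colour [j] would be equal, yet one is
    positive and the other is not.  The two halves of an alternating closed walk
    are such families. *)
Lemma no_balanced_pair (j : nat) (A B : seq (V * V)) :
  A != [::] -> perm_eq (flatten (map (@ends _) A)) (flatten (map (@ends _) B)) ->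
  {in A, forall e, [set e.1; e.2] \in E /\ c [set e.1; e.2] = j} ->
  {in B, forall e, [set e.1; e.2] \in E /\ (j < c [set e.1; e.2])%N} -> False.
Proof.
case: valid => _ _ pos neg A0 AB HA HB.
have sumE s : \sum_(e <- s) (w j e.1 + w j e.2) =
    \sum_(x <- flatten (map (@ends _) s)) w j x.
  by rewrite big_flatten big_map; apply: eq_bigr => e _; rewrite big_cons big_seq1.
have : \sum_(e <- B) (w j e.1 + w j e.2) <= 0.
  rewrite big_seq; apply: sumr_le0 => e /HB[eE je].
  by apply: ltW; apply: neg.
rewrite !sumE -(perm_big _ AB) -sumE.
case: A A0 AB HA => // e A _ _ HA; rewrite big_cons leNgt => /negP; apply.
apply: ltr_pwDl.
  by have [eE <-] := HA e (mem_head _ _); apply: pos.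
rewrite big_seq; apply: sumr_ge0 => f fA.
have fA' : f \in e :: A by rewrite inE fA orbT.
by have [fE <-] := HA f fA'; apply: ltW; apply: pos.
Qed.
End ValidColouring.

Section LowerBounds.
Variables (n k : nat).
Hypotheses (n2 : (2 < n)%N) (k0 : (0 < k)%N) (kn : (2 * k <= n)%N).

Let nextv (x : 'Z_n + 'Z_n) : 'Z_n + 'Z_n :=
  match x with inl i => inl (i + 1) | inr i => inr (i + k%:R) end.
Let prevv (x : 'Z_n + 'Z_n) : 'Z_n + 'Z_n :=
  match x with inl i => inl (i - 1) | inr i => inr (i - k%:R) end.
Let twin (x : 'Z_n + 'Z_n) : 'Z_n + 'Z_n :=
  match x with inl i => inr i | inr i => inl i end.

Let next_edge x : [set x; nextv x] \in GP n k.
Proof.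
case: x => i; rewrite !inE -orbA; apply/or3P.
  by apply: Or31; apply/imsetP; exists i.
by apply: Or32; apply/imsetP; exists i.
Qed.

Let prev_edge x : [set x; prevv x] \in GP n k.
Proof.
have -> : x = nextv (prevv x) by case: x => i /=; rewrite subrK.
have -> : prevv (nextv (prevv x)) = prevv x by case: x => i /=; rewrite subrK.
by rewrite setUC next_edge.
Qed.

Let twin_edge x : [set x; twin x] \in GP n k.
Proof.
rewrite !inE -orbA; apply/or3P/Or33/imsetP.
by case: x => i; exists i => //; rewrite setUC.
Qed.

Let double_neq0 a (i : 'Z_n) : (0 < 2 * a < n)%N -> i + a%:R != i - a%:R.
Proof.
move=> /andP[a0 an]; rewrite -subr_eq0 opprB addrC addrA subrK -natrD addnn -mul2n.
rewrite -val_eqE /= val_Zp_nat ?modn_small //; lia.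
Qed.

Lemma pmd_GP_ge3 (R : realType) q : has_pmd R (GP n k) q -> (3 <= q)%N.
Proof.
move=> /has_pmd_valid_colouring[c [w valid]].
apply: (colours_ge3 valid next_edge prev_edge twin_edge (x := inl 0)) => //.
by rewrite (inj_eq inl_inj) (@double_neq0 1) //; lia.
Qed.

Lemma pmd_GP_ge4 (R : realType) q : n != (2 * k)%N ->
  has_pmd R (GP n k) q -> (4 <= q)%N.
Proof.
move=> n2k /has_pmd_valid_colouring[c [w valid]].
apply: (colours_ge4 valid (inl 0) next_edge prev_edge twin_edge).
- by apply: (can_inj (g := prevv)) => -[] i /=; rewrite addrK.
- by apply: (can_inj (g := nextv)) => -[] i /=; rewrite subrK.
- by apply: (can_inj (g := twin)) => -[].
- move=> [] i; split=> //=.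
  + by rewrite (inj_eq inl_inj) (@double_neq0 1) //; lia.
  + by rewrite (inj_eq inr_inj) double_neq0 //; lia.
Qed.
End LowerBounds.

(** * Exhaustive search with alternating closed walks *)

Local Open Scope nat_scope.

(** Vertices are numbers, edges are pairs of numbers listed in [es] and referred to
    by their position, and a partial colouring is the sequence of the colours
    of the first edges. *)
Section Search.
Variable es : seq (nat * nat).

Let edge i := nth (0, 0) es i.

(** Extensions of the trail [t] from [start] to [x] to a closed trail with at most
    [len] further edges.  All vertices are at least [start], so that cycles appear
    once per direction: the two directions exchange the halves. *)
Fixpoint closed_trails (len start x : nat) (t : seq nat) : seq (seq nat) :=
  if len is l.+1 then
    flatten [seq let y := if (edge i).1 == x then (edge i).2 else (edge i).1 in
      if y == start then [:: rcons t i]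
      else if start < y then closed_trails l start y (rcons t i) else [::]
    | i <- iota 0 (size es) & (i \notin t) && (x \in ends (edge i))]
  else [::].

Definition alternate (t : seq nat) : seq nat * seq nat :=
  ([seq nth 0 t i | i <- iota 0 (size t) & ~~ odd i],
   [seq nth 0 t i | i <- iota 0 (size t) & odd i]).

Definition balanced (AB : seq nat * seq nat) : bool :=
  (AB.1 != [::]) && perm_eq (flatten [seq ends (edge i) | i <- AB.1])
                            (flatten [seq ends (edge i) | i <- AB.2]).

(** Filtering by [balanced] makes the search sound whatever [closed_trails]
    produces. *)
Definition alternating (len : nat) : seq (seq nat * seq nat) :=
  filter balanced (map alternate
    (flatten [seq closed_trails len x x [::]
             | x <- undup (flatten (map (@ends _) es))])).

Definition clash (i j : nat) : bool :=
  has (mem (ends (edge i))) (ends (edge j)) &&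
  ~~ all (mem (ends (edge i))) (ends (edge j)).

(** Only the last coloured edge is compared with the earlier ones, since [refuted]
    tests all prefixes. *)
Definition violated (obs : seq (seq nat * seq nat)) (s : seq nat) : bool :=
  let m := size s in let c := nth 0 s in
  has (fun i => clash i m.-1 && (c i == c m.-1)) (iota 0 m) ||
  has (fun AB => let j := c (head 0 AB.1) in
    all (fun i => (i < m) && (c i == j)) AB.1 &&
    all (fun i => (i < m) && (j < c i)) AB.2) obs.

(** The conditional, rather than a disjunction, prunes the search under
    call-by-value evaluation. *)
Fixpoint refuted (q : nat) obs (s : seq nat) (fuel : nat) : bool :=
  if violated obs s then true else
  if fuel is f.+1 then all (fun c => refuted q obs (rcons s c) f) (iota 0 q)
  else false.

Variables (R : realType) (V : finType) (E : graph V) (code : nat -> V).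
Hypothesis code_inj : {in flatten (map (@ends _) es) &, injective code}.
Hypothesis code_edge : {in es, forall e, [set code e.1; code e.2] \in E}.

Lemma refuted_colours q len : refuted q (alternating len) [::] (size es) ->
  forall q', has_pmd R E q' -> q < q'.
Proof.
move=> ref q' /has_pmd_valid_colouring[c [w valid]]; rewrite ltnNge; apply/negP=> qq'.
pose arc (e : nat * nat) := (code e.1, code e.2).
pose col i := c [set (arc (edge i)).1; (arc (edge i)).2].
have edge_in i : i < size es -> edge i \in es by apply: mem_nth.
have arcE i : i < size es -> [set (arc (edge i)).1; (arc (edge i)).2] \in E.
  by move=> /edge_in/code_edge.
have ends_in i : i < size es -> {subset ends (edge i) <= flatten (map (@ends _) es)}.
  by move=> /edge_in ie x xi; apply/flattenP; exists (ends (edge i)); rewrite ?map_f.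
have clashP i j : i < size es -> j < size es -> clash i j -> col i <> col j.
  move=> ilt jlt /andP[/hasP[x xj xi] /allPn[y yj yi]] cc.
  case: (valid) => _ cE _ _.
  have meet : ~~ [disjoint [set code (edge i).1; code (edge i).2]
                 & [set code (edge j).1; code (edge j).2]].
    apply/pred0Pn; exists (code x); rewrite /= !in_set2.
    by move: xj xi; rewrite !inE => /orP[]/eqP -> /orP[]/eqP ->; rewrite eqxx ?orbT.
  have := cE _ _ (arcE _ ilt) (arcE _ jlt) cc meet => /setP/(_ (code y)).
  rewrite !in_set2 => Ey; case/negP: yi.
  have : (code y == code (edge j).1) || (code y == code (edge j).2).
    by move: yj; rewrite !inE => /orP[]/eqP ->; rewrite eqxx ?orbT.
  rewrite -Ey.
  have [yV iV] := (ends_in _ jlt _ yj, ends_in _ ilt).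
  by case/orP=> /eqP/code_inj-> //; rewrite ?iV // !inE eqxx ?orbT.
have no_violation m : m <= size es -> violated (alternating len) (mkseq col m) = false.
  move=> ms; apply/negP; rewrite /violated size_mkseq => /orP[/hasP[i]|/hasP[AB]].
    rewrite mem_iota add0n => /andP[_ im] /andP[cl].
    have m1 : m.-1 < m by lia.
    by rewrite !nth_mkseq // => /eqP; apply: clashP cl; apply: leq_trans ms.
  rewrite mem_filter => /andP[/andP[A0 bal] _] /andP[/allP HA /allP HB].
  set j := nth 0 _ _ in HA HB.
  apply: (@no_balanced_pair R V E q' c w valid j
    [seq arc (edge i) | i <- AB.1] [seq arc (edge i) | i <- AB.2]).
  - by case: (AB.1) A0.
  - have code_ends s : flatten (map (@ends V) [seq arc (edge i) | i <- s]) =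
        map code (flatten [seq ends (edge i) | i <- s]).
      by rewrite map_flatten -!map_comp.
    by rewrite !code_ends perm_map.
  - move=> e /mapP[i /HA/andP[im /eqP ci] ->].
    have ies := leq_trans im ms.
    by split; [apply: arcE | rewrite -ci nth_mkseq].
  - move=> e /mapP[i /HB/andP[im ci] ->].
    have ies := leq_trans im ms.
    by split; [apply: arcE | move: ci; rewrite nth_mkseq].
have col_lt i : i < size es -> col i < q.
  move=> /arcE ie; case: (valid) => lt _ _ _; exact: leq_trans (lt _ ie) qq'.
suff Hm f m : m + f = size es -> refuted q (alternating len) (mkseq col m) f = false.
  by move: ref; rewrite (Hm (size es) 0).
elim: f m => [|f IH] m mf /=; rewrite no_violation //; try lia.
apply/negP=> /allP/(_ (col m)); rewrite mem_iota add0n /= col_lt; last lia.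
have -> : rcons (mkseq col m) (col m) = mkseq col m.+1.
  by rewrite /mkseq -addn1 iotaD map_cat cats1.
by rewrite IH; [move/(_ isT) | lia].
Qed.
End Search.

(** For [n = 2k] the [k] inner edges are listed once. *)
Definition gp_edges (n k : nat) : seq (nat * nat) :=
  [seq (i, (i + 1) %% n) | i <- iota 0 n] ++ [seq (i, n + i) | i <- iota 0 n] ++
  [seq (n + i, n + (i + k) %% n) | i <- iota 0 (if n == 2 * k then k else n)].

Definition vertex n (x : nat) : 'Z_n + 'Z_n :=
  if x < n then inl x%:R%R else inr (x - n)%:R%R.
Arguments vertex : clear implicits.

Lemma Zp_nat_inj n a b : 1 < n -> a < n -> b < n ->
  a%:R%R = b%:R%R :> 'Z_n -> a = b.
Proof.
move=> n1 an bn /(congr1 (@nat_of_ord _)).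
by rewrite !val_Zp_nat // !modn_small.
Qed.

Lemma vertex_inj n : 1 < n -> {in gtn (2 * n) &, injective (vertex n)}.
Proof.
move=> n1 x y; rewrite !unfold_in /= /vertex => xn yn.
case: ltnP => xlt; case: ltnP => ylt // E.
  exact: Zp_nat_inj n1 xlt ylt (inl_inj E).
have := Zp_nat_inj n1 _ _ (inr_inj E); lia.
Qed.

Lemma gp_edgesP n k : 2 < n -> k <= n -> {in gp_edges n k, forall e,
  [/\ e.1 < 2 * n, e.2 < 2 * n & [set vertex n e.1; vertex n e.2] \in GP n k]}.
Proof.
move=> n2 kn e; have n1 : 1 < n by lia.
have modZ m : (m %% n)%:R%R = m%:R%R :> 'Z_n by rewrite Zp_nat_mod.
rewrite !mem_cat => /or3P[] /mapP[i]; rewrite mem_iota add0n => /= ilt -> /=.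
- have lt : (i + 1) %% n < n by rewrite ltn_mod; lia.
  split; [lia | lia |]; rewrite !inE; apply/orP; left; apply/orP; left.
  by apply/imsetP; exists i%:R%R; rewrite // /vertex ilt lt modZ natrD.
- split; [lia | lia |]; rewrite !inE; apply/orP; right.
  apply/imsetP; exists i%:R%R; rewrite // /vertex ilt ltnNge leq_addr /=.
  by rewrite addnC addnK.
- have lt : (i + k) %% n < n by rewrite ltn_mod; lia.
  have {}ilt : i < n by case: ifP ilt; lia.
  split; [lia | lia |]; rewrite !inE; apply/orP; left; apply/orP; right.
  apply/imsetP; exists i%:R%R; rewrite // /vertex !ltnNge !leq_addr /=.
  by rewrite ![n + _]addnC !addnK modZ natrD.
Qed.

Lemma gp_refuted (R : realType) n k q len : 2 < n -> k <= n ->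
  refuted (gp_edges n k) q (alternating (gp_edges n k) len) [::]
    (size (gp_edges n k)) ->
  forall q', has_pmd R (GP n k) q' -> q < q'.
Proof.
move=> n2 kn; apply: (@refuted_colours _ R _ _ (vertex n)) => [x y xe ye|e].
  have n1 : 1 < n by lia.
  have lt z : z \in flatten (map (@ends _) (gp_edges n k)) -> z < 2 * n.
    case/flattenP=> _ /mapP[e /(gp_edgesP n2 kn)[lt1 lt2 _] ->].
    by rewrite !inE => /orP[]/eqP ->.
  by apply: (vertex_inj n1); apply: lt.
by case/(gp_edgesP n2 kn).
Qed.

(** The lengths 8 and 6 are the smallest that make the search succeed. *)
Lemma pmd_GP41_gt4 (R : realType) q : has_pmd R (GP 4 1) q -> 4 < q.
Proof. by apply: (@gp_refuted R 4 1 4 8); last vm_compute. Qed.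

Lemma pmd_GP63_gt3 (R : realType) q : has_pmd R (GP 6 3) q -> 3 < q.
Proof. by apply: (@gp_refuted R 6 3 3 6); last vm_compute. Qed.

Theorem proposition4p3 (R : realType) (n k : nat)
    (hn : (3 <= n)%N) (hk1 : (1 <= k)%N) (hkn : (2 * k <= n)%N) :
  pmd_eq R (GP n k)
    (if (n == 2 * k)%N && (k != 3%N) then 3%N
     else if (n == 4%N) && (k == 1%N) then 5%N
     else 4%N).
Proof.
case: eqP => [n2k|/eqP n2k] /=.
  case: eqP => [k3|k3] /=.
    rewrite n2k k3 /=; split; first exact: has_pmd_GP63.
    exact: pmd_GP63_gt3.
  split=> [|q]; last exact: pmd_GP_ge3.
  rewrite n2k; have [ok|ek] := boolP (odd k).
    by apply: has_pmd_double_odd => //; lia.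
  by apply: has_pmd_double_even => //; lia.
case: andP => [[/eqP -> /eqP ->]|n41].
  by split; [apply: has_pmd_GP41 | apply: pmd_GP41_gt4].
split=> [|q]; last exact: pmd_GP_ge4.
apply: has_pmd_GP4 => //; first lia.
by apply/negP; rewrite xpair_eqE => /andP.
Qed.
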